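(* Let $n$ be a positive integer. Consider $\mathbb{R}^n$ as a topological manifold, and let $\mathcal{A}_n$ be the collection of all pairs $(\mathbb{R}^n, F)$, where $F : \mathbb{R}^n \to \mathbb{R}^n$ is a polynomial map whose Jacobian determinant is identically equal to some real constant $c \neq 0$ (with $c$ depending on $F$). Then the pair $(\mathbb{R}^n, \mathcal{A}_n)$ determines a polynomial manifold if and only if the Jacobian conjecture over $\mathbb{R}$ (in dimension $n$) is true.
   Context: A polynomial map $F:\mathbb{R}^n \to \mathbb{R}^n$ is a map whose component functions $\mathbb{R}^n \to \mathbb{R}$ are polynomials; $|J_F|$ denotes its Jacobian determinant, and $|J_F| \equiv c$ means it is identically equal to $c$. Jacobian conjecture over $\mathbb{R}$ (for the given $n$): if $F : \mathbb{R}^n \to \mathbb{R}^n$ is a polynomial map satisfying $|J_F| \equiv c$ for some real $c \neq 0$, then $F$ is invertible and $F^{-1}$ is a polynomial map. A topological $n$-manifold is a Hausdorff, second countable topological space in which each point has a neighborhood homeomorphic to $\mathbb{R}^n$. A chart on a topological $n$-manifold $M$ is a pair $(U, \varphi)$ where $U$ is an open subset of $M$ and $\varphi : U \to \mathbb{R}^n$ is a homeomorphism. An atlas on $M$ is a collection of charts $\{(U_\alpha, \varphi_\alpha)\}$ on $M$ such that the sets $U_\alpha$ cover $M$. A polynomial atlas on $M$ is an atlas $\mathcal{A}$ on $M$ such that for any charts $(U,\varphi)$ and $(V,\psi)$ in $\mathcal{A}$, either $U \cap V$ is empty, or the maps $\psi \circ \varphi^{-1} : \varphi(U\cap V) \to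 \psi(U \cap V)$ and $\varphi \circ \psi^{-1} : \psi(U \cap V) \to \varphi(U \cap V)$ are restrictions of polynomial maps; that is, there exist polynomial maps $P, Q : \mathbb{R}^n \to \mathbb{R}^n$ with $\psi \circ \varphi^{-1} = P|_{\varphi(U \cap V)}$ and $\varphi \circ \psi^{-1} = Q|_{\psi(U\cap V)}$. A polynomial $n$-manifold is a pair $(M, \overline{\mathcal{A}})$ where $M$ is a topological $n$-manifold and $\overline{\mathcal{A}}$ is a maximal polynomial atlas on $M$. Given a collection $\mathcal{A}$ of pairs $(U,\varphi)$ with $U \subseteq M$ and $\varphi : U \to \mathbb{R}^n$, the pair $(M, \mathcal{A})$ is said to determine a polynomial manifold when $\mathcal{A}$ is a polynomial atlas on $M$ (in particular, every member of $\mathcal{A}$ is a chart); such an atlas is then contained in a maximal polynomial atlas. *)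

(* Defs.v *)
(* MathComp-Analysis, over an arbitrary [R : realType]; R^n is ['rV[R]_n]. *)
From HB Require Import structures.
From mathcomp Require Import all_boot all_order all_algebra.
From mathcomp Require Import all_classical all_reals all_analysis.
(* Not imported: the notations of [mpoly] clash with those of the analysis
   library. *)
From mathcomp.multinomials Require mpoly.

Set Implicit Arguments.
Unset Strict Implicit.
Unset Printing Implicit Defensive.

Import Order.TTheory GRing.Theory Num.Theory numFieldNormedType.Exports.

Local Open Scope classical_set_scope.
Local Open Scope ring_scope.

Definition polynomial_map (R : realType) (n : nat)
    (F : 'rV[R]_n -> 'rV[R]_n) : Prop :=
  exists p : 'I_n -> mpoly.mpoly n R,
    forall (x : 'rV[R]_n) (i : 'I_n),
      F x ord0 i = mpoly.meval (fun j : 'I_n => x ord0 j) (p i).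

(* ['J F x] acts on row vectors, hence is the transpose of the usual Jacobian
   matrix; the determinant is the same. *)
Definition jacobian_det (R : realType) (n : nat)
    (F : 'rV[R]_n -> 'rV[R]_n) (x : 'rV[R]_n) : R :=
  \det ('J F x).

Definition nonzero_constant_jacobian (R : realType) (n : nat)
    (F : 'rV[R]_n -> 'rV[R]_n) : Prop :=
  exists2 c : R, c != 0 & forall x, jacobian_det F x = c.

Definition jacobian_conjecture (R : realType) (n : nat) : Prop :=
  forall F : 'rV[R]_n -> 'rV[R]_n,
    polynomial_map F -> nonzero_constant_jacobian F ->
    exists G : 'rV[R]_n -> 'rV[R]_n,
      [/\ cancel F G, cancel G F & polynomial_map G].

Definition homeomorphism (X Y : topologicalType) (f : X -> Y) : Prop :=
  exists g : Y -> X,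
    [/\ cancel f g, cancel g f, continuous f & continuous g].

(* Here and below a set [U : set M] used as a type is [set_type U], which
   carries the subspace topology. *)
Definition topological_manifold (R : realType) (n : nat)
    (M : topologicalType) : Prop :=
  [/\ hausdorff_space M,
      @second_countable M
    & forall x : M, exists2 U : set M, nbhs x U &
        exists phi : U -> 'rV[R]_n, homeomorphism phi].

(* A pair (U, phi) with U a subset of M and phi : U -> R^n, not yet required to
   be a chart. *)
Record coord_pair (R : realType) (n : nat) (M : topologicalType) := CoordPair {
  domain : set M;
  coord :> domain -> 'rV[R]_n }.

Definition is_chart (R : realType) (n : nat) (M : topologicalType)
    (a : coord_pair R n M) : Prop :=
  open (domain a) /\ homeomorphism a.

Definition is_atlas (R : realType) (n : nat) (M : topologicalType)
    (A : set (coord_pair R n M)) : Prop :=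
  (forall a, A a -> is_chart a) /\
  \bigcup_(a in A) domain a = [set: M].

Section Transition.
Variables (R : realType) (n : nat) (M : topologicalType).
Variables a b : coord_pair R n M.

(* phi(U `&` V) for a = (U, phi) and b = (V, psi) *)
Definition overlap_image : set 'rV[R]_n :=
  a @` [set u | domain b (\val u)].

Lemma overlap_preimage (y : overlap_image) :
  {u : domain a | domain b (\val u) & a u = \val y}.
Proof. by apply: cid2; exact: (set_valP y). Qed.

(* psi \o phi^-1 on phi(U `&` V): [overlap_preimage y] picks a phi-preimage of
   y, which is unique, hence phi^-1 y, when [a] is a chart. *)
Definition transition (y : overlap_image) : 'rV[R]_n :=
  b (exist _ (\val (s2val (overlap_preimage y)))
           (mem_set (s2valP (overlap_preimage y)))).

Definition polynomial_transition : Prop :=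
  exists2 P : 'rV[R]_n -> 'rV[R]_n, polynomial_map P &
    forall y : overlap_image, transition y = P (\val y).

End Transition.

Definition polynomial_atlas (R : realType) (n : nat) (M : topologicalType)
    (A : set (coord_pair R n M)) : Prop :=
  is_atlas A /\
  forall a b, A a -> A b ->
    domain a `&` domain b = set0 \/
    (polynomial_transition a b /\ polynomial_transition b a).

Definition determines_polynomial_manifold (R : realType) (n : nat)
    (M : topologicalType) (A : set (coord_pair R n M)) : Prop :=
  topological_manifold R n M /\ polynomial_atlas A.

Definition jacobian_pairs (R : realType) (n : nat) :
    set (coord_pair R n 'rV[R]_n) :=
  [set a | exists F : 'rV[R]_n -> 'rV[R]_n,
     [/\ polynomial_map F, nonzero_constant_jacobian F
       & a = CoordPair (fun u : [set: 'rV[R]_n] => F (\val u))]].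

Arguments jacobian_pairs R n : clear implicits.

(* Main.v *)
(* The identity is a member of A_n, and the transition from (R^n, F) to
   (R^n, id) is F^-1, so polynomiality of the transitions forces every F^-1 to
   be polynomial. Conversely, if all F^-1 are polynomial then every F is a
   homeomorphism and every transition G \o F^-1 is a polynomial map. *)
Require Import Defs.
From mathcomp Require Import all_boot all_order all_algebra.
From mathcomp Require Import all_classical all_reals all_analysis.
From mathcomp.multinomials Require mpoly.

Set Implicit Arguments.
Unset Strict Implicit.
Unset Printing Implicit Defensive.

Import Order.TTheory GRing.Theory Num.Theory numFieldNormedType.Exports.

Local Open Scope classical_set_scope.
Local Open Scope ring_scope.

(** The balls of radius [k.+1%:R^-1] about the points with rational coordinates form a countable
    basis. *)
Lemma rV_second_countable (R : realType) (n : nat) :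
  @second_countable 'rV[R]_n.
Proof.
pose B (ck : 'rV[rat]_n * nat) : set 'rV[R]_n :=
  ball (map_mx ratr ck.1 : 'rV[R]_n) ck.2.+1%:R^-1.
exists (range B); first exact: sub_countable (card_image_le _ _) (countableP _).
split=> [_ [ck _ <-]|x V /nbhs_ballP[e /= e0 xeV]].
  by apply: ball_open; rewrite invr_gt0.
(* With radius below [e / 2], any such ball that contains [x] lies inside the ball of radius [e]
   about [x]. *)
have [k] : exists k : nat, 0 + k.+1%:R^-1 < e / 2.
  by apply: ltr_add_invr; rewrite divr_gt0.
rewrite add0r => ke.
have k0 : 0 < k.+1%:R^-1 :> R by rewrite invr_gt0.
(* Balls of row vectors are products of balls, so the centre can be chosen one coordinate at a
   time. *)
have /boolp.choice[q xq] : forall i, exists q : rat,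
    ball (x ord0 i) k.+1%:R^-1 (ratr q).
  move=> i; have : x ord0 i < x ord0 i + k.+1%:R^-1 by rewrite ltrDl.
  move=> /rat_in_itvoo[r]; rewrite in_itv /= => /andP[xr rx]; exists r.
  by rewrite /ball /= distrC ltr_distl rx andbT (le_lt_trans _ xr)// gerBl ltW.
have Bx : B (\row_i q i, k) x.
  by split=> // i j; rewrite ord1 !mxE /=; exact: ball_sym.
exists (B (\row_i q i, k)); first by split=> //; eexists.
move=> y By; apply: xeV; rewrite [e]splitr.
apply: (ball_triangle (y := map_mx ratr (\row_i q i) : 'rV[R]_n)).
  exact/ball_sym/(le_ball (ltW ke)).
exact: (le_ball (ltW ke)).
Qed.

Lemma polynomial_map_id (R : realType) (n : nat) :
  polynomial_map (@id 'rV[R]_n).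
Proof.
exists (fun i => mpoly.mpolyX R (mpoly.mnm1 i)) => x i.
by rewrite mpoly.mevalXU.
Qed.

Lemma polynomial_map_comp (R : realType) (n : nat)
    (F G : 'rV[R]_n -> 'rV[R]_n) :
  polynomial_map F -> polynomial_map G -> polynomial_map (F \o G).
Proof.
move=> [p Fp] [q Gq].
exists (fun i => mpoly.comp_mpoly (mktuple q) (p i)) => x i.
rewrite mpoly.comp_mpoly_meval /= Fp; congr mpoly.meval.
by apply/funext => j; rewrite tnth_mktuple Gq.
Qed.

(** A neighbourhood of a row vector contains a box, which imposes finitely many coordinate
    conditions; [filter_forall] combines them. *)
Lemma continuous_rV (R : realType) (T : topologicalType) (n : nat)
    (F : T -> 'rV[R]_n) :
  (forall i, continuous (fun x => F x ord0 i)) -> continuous F.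
Proof.
move=> Fc x A [P Px PA]; rewrite /nbhs /=.
have : \forall y \near x, forall i, P ord0 i (F y ord0 i).
  apply: filter_forall => i; exact: Fc (Px ord0 i).
by apply: filterS => y Py; apply: PA => i j; rewrite ord1.
Qed.

Lemma polynomial_map_continuous (R : realType) (n : nat)
    (F : 'rV[R]_n -> 'rV[R]_n) :
  polynomial_map F -> continuous F.
Proof.
move=> [p Fp]; apply: continuous_rV => i.
rewrite (_ : (fun x => _) = (fun x : 'rV[R]_n =>
  mpoly.meval (fun j => x ord0 j) (p i))); last exact/funext.
(* The polynomial becomes a finite sum of monomials with coefficients. *)
under eq_fun do rewrite mpoly.mevalE.
apply: continuous_big => [|m _]; first exact: add_continuous.
have monom_continuous : continuous (fun x : 'rV[R]_n =>
    \prod_(j < n) x ord0 j ^+ mpoly.fun_of_multinom m j).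
  apply: continuous_big => [|j _]; first exact: mul_continuous.
  move=> x; apply: (@continuous_comp _ _ _ (fun y : 'rV[R]_n => y ord0 j)
    (fun t => t ^+ mpoly.fun_of_multinom m j)).
    exact: coord_continuous.
  exact: exprn_continuous.
move=> x; apply: (continuous_comp (monom_continuous x)).
exact: mulrl_continuous.
Qed.

Lemma jacobian_det_id (R : realType) (n : nat) (x : 'rV[R]_n) :
  jacobian_det id x = 1.
Proof.
rewrite /jacobian_det /jacobian diff_val.
rewrite (_ : lin1_mx _ = 1%:M) ?det1//.
by apply/matrixP => i j; rewrite !mxE eqxx /= eq_sym.
Qed.

Section GlobalPair.
Variables (R : realType) (n : nat).
Implicit Types F G H : 'rV[R]_n -> 'rV[R]_n.

Definition global_pair F : coord_pair R n 'rV[R]_n :=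
  CoordPair (fun u : [set: 'rV[R]_n] => F (\val u)).

Lemma jacobian_pairs_global F : polynomial_map F ->
  nonzero_constant_jacobian F -> jacobian_pairs R n (global_pair F).
Proof. by move=> Fp FJ; exists F. Qed.

Lemma jacobian_pairs_id : jacobian_pairs R n (global_pair id).
Proof.
apply: jacobian_pairs_global; first exact: polynomial_map_id.
by exists 1; [exact: oner_neq0 | exact: jacobian_det_id].
Qed.

Lemma homeomorphism_global F G : cancel F G -> cancel G F ->
  continuous F -> continuous G -> homeomorphism (global_pair F).
Proof.
move=> FK GK Fc Gc; exists (fun y => exist _ (G y) (mem_set I)); split.
- by move=> u; apply: val_inj; rewrite /= FK.
- by move=> y; rewrite /= GK.
- move=> u; apply: (@continuous_comp _ _ _ (@set_val _ setT) F).
    exact: initial_continuous.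
  exact: Fc.
(* The subspace topology is initial for [\val], so only the continuity of [G] is at stake. *)
- exact: continuous_comp_initial.
Qed.

Lemma homeomorphism_global_cancel F : homeomorphism (global_pair F) ->
  exists2 G, cancel F G & cancel G F.
Proof.
move=> [g [Fg gF _ _]]; exists (fun y => \val (g y)) => [x|y].
  by have /(congr1 val) := Fg (exist _ x (mem_set I)).
exact: gF.
Qed.

(** The preimage picked by [overlap_preimage] is unspecified, but cancellation forces it to be
    [G (\val y)]. *)
Lemma transition_global F G H (y : overlap_image (global_pair F)
    (global_pair H)) : cancel F G -> transition y = H (G (\val y)).
Proof.
move=> FK; rewrite /transition /=.
by case: (overlap_preimage y) => u _ /= <-; rewrite FK.
Qed.

Lemma polynomial_transition_global F G H : cancel F G -> cancel G F ->
  polynomial_transition (global_pair F) (global_pair H) <->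
  polynomial_map (H \o G).
Proof.
move=> FK GK; split=> [[P Pp PE]|HGp]; last first.
  by exists (H \o G) => // y; exact: transition_global.
rewrite (_ : H \o G = P)//; apply/funext => v.
(* Both domains are the whole space and [F] is onto, so the overlap image is all of R^n and [P] is
   determined everywhere. *)
have vF : v \in overlap_image (global_pair F) (global_pair H).
  by apply/mem_set; exists (exist _ (G v) (mem_set I)); rewrite //= GK.
by rewrite -(PE (exist _ v vF)) (transition_global _ FK).
Qed.

End GlobalPair.

Theorem theorem1 (R : realType) (n : nat) (hn : (0 < n)%N) :
  determines_polynomial_manifold (jacobian_pairs R n) <->
  jacobian_conjecture R n.
Proof.
split=> [[_ [[charts _] transitions]] F Fp FJ|JC].
  have AF := jacobian_pairs_global Fp FJ.
  (* Invertibility of [F] comes from the chart condition alone; the transition to the identity chart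
     then makes [G] polynomial. *)
  have [_ /homeomorphism_global_cancel[G FK GK]] := charts _ AF.
  exists G; split=> //.
  (* The empty-overlap alternative fails because both domains contain 0. *)
  have [/= TT0|[+ _]] := transitions _ _ AF (jacobian_pairs_id R n).
    by have [] : (set0 : set 'rV[R]_n) 0 by rewrite -TT0.
  by move/(polynomial_transition_global _ FK GK).
have id_homeo : homeomorphism (global_pair (@id 'rV[R]_n)).
  by apply: (@homeomorphism_global _ _ id id) => // x; exact: cvg_id.
split; [split|split; [split|]].
- exact: norm_hausdorff.
- exact: rV_second_countable.
- move=> x; exists setT; first exact: filterT.
  by exists (global_pair id).
- move=> _ [F [Fp FJ ->]]; split; first exact: openT.
  have [G [FK GK Gp]] := JC F Fp FJ.
  by apply: (homeomorphism_global FK GK); exact: polynomial_map_continuous.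
- apply/seteqP; split=> // x _.
  by exists (global_pair id); first exact: jacobian_pairs_id.
- move=> _ _ [F [Fp FJ ->]] [F' [F'p F'J ->]]; right.
  have [G [FK GK Gp]] := JC F Fp FJ.
  have [G' [F'K G'K G'p]] := JC F' F'p F'J.
  (* The two transitions are [F' \o G] and [F \o G'], composites of polynomial maps. *)
  split.
    by apply/(polynomial_transition_global _ FK GK); exact: polynomial_map_comp.
  by apply/(polynomial_transition_global _ F'K G'K); exact: polynomial_map_comp.
Qed.
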